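(* Let $i,j\ge1$ be integers and let $S^{(L)},S^{(M)},S^{(R)}$ be three independent simple symmetric nearest-neighbour random walks on $\mathbb Z$ started from $-2i$, $0$ and $2j$ respectively. Let $\tau_{(L,M)}=\inf\{n\ge1:S_n^{(L)}=S_n^{(M)}\}$, $\tau_{(M,R)}=\inf\{n\ge1:S_n^{(M)}=S_n^{(R)}\}$ and $\tau_C=\min\{\tau_{(L,M)},\tau_{(M,R)}\}$. Then $$\mathbb E(\tau_C)=4ij.$$
   Context: The walks are $S_n^{(L)}=-2i+\sum_{k=1}^nI_k^{(L)}$, $S_n^{(M)}=\sum_{k=1}^nI_k^{(M)}$, $S_n^{(R)}=2j+\sum_{k=1}^nI_k^{(R)}$, where $\{I_k^{(L)}\}_{k\ge1},\{I_k^{(M)}\}_{k\ge1},\{I_k^{(R)}\}_{k\ge1}$ are three independent sequences of i.i.d. random variables taking values $+1$ and $-1$ with probability $1/2$ each. *)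

(* Defs.v *)
From HB Require Import structures.
From mathcomp Require Import all_boot all_order all_algebra finmap.
From mathcomp Require Import all_classical all_reals all_analysis.

Set Implicit Arguments.
Unset Strict Implicit.
Unset Printing Implicit Defensive.

Import Order.TTheory GRing.Theory Num.Theory.

Local Open Scope classical_set_scope.
Local Open Scope ring_scope.

HB.instance Definition _ := isPointed.Build int 0.

(* The discrete sigma-algebra on int, as the library does for nat; it makes
   {RV P >-> int} the type of integer-valued random variables. *)
HB.instance Definition _ := @isMeasurable.Build default_measure_display
  int discrete_measurable discrete_measurable0
  discrete_measurableC discrete_measurableU.

Section Independence.
Context (d : measure_display) (T : measurableType d) (R : realType).
Variable P : probability T R.

Definition independent_families (I : choiceType)
    (F : I -> set (set T)) : Prop :=
  forall (J : {fset I}) (E : I -> set T),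
    (forall i, i \in J -> F i (E i)) ->
    P (\bigcap_(i in [set` J]) E i) = (\prod_(i <- J) P (E i))%E.

(* The sigma-algebra generated by the whole sequence X. *)
Definition sigma_seq (X : nat -> {RV P >-> int}) : set (set T) :=
  <<s \bigcup_k g_sigma_algebra_preimage (X k) >>.

Definition iid_fair_signs (X : nat -> {RV P >-> int}) : Prop :=
  (forall k, P (X k @^-1` [set 1]) = (2^-1)%:E /\
             P (X k @^-1` [set -1]) = (2^-1)%:E) /\
  independent_families (fun k => g_sigma_algebra_preimage (X k)).

Definition independent_sequences3 (X Y Z : nat -> {RV P >-> int}) : Prop :=
  independent_families
    (tnth [tuple sigma_seq X; sigma_seq Y; sigma_seq Z]).

End Independence.

Section Walks.
Context (T : Type) (R : realType).

(* Steps are indexed from 0: X k is the (k+1)-st increment, so the walk at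
   time n is x + X 0 + ... + X (n-1). *)
Definition walk (x : int) (X : nat -> T -> int) (n : nat) (w : T) : int :=
  x + \sum_(k < n) X k w.

(* ereal_inf set0 = +oo, so the time is +oo when the walks never meet. *)
Definition meeting_time (S S' : nat -> T -> int) (w : T) : \bar R :=
  ereal_inf [set n%:R%:E | n in [set n | (1 <= n)%N /\ S n w = S' n w]].

Definition collision_time (SL SM SR : nat -> T -> int) (w : T) : \bar R :=
  Order.min (meeting_time SL SM w) (meeting_time SM SR w).

End Walks.

(* Main.v *)
Require Import Defs.
From mathcomp Require Import all_boot all_order all_algebra finmap.
From mathcomp Require Import all_classical all_reals all_analysis.
From mathcomp Require Import measurable_realfun ring lra zify.

(** Follow the two half-gaps x = (M - L) / 2 and y = (R - M) / 2, which start
    at (i, j) and move by at most 1 in each coordinate, so that they stay in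
    the quadrant x, y >= 0 and the collision time tau is the first time at
    which x y = 0.

    A step of the walks leaves x and y fair but correlates them negatively,
    because M enters the two gaps with opposite signs: the mean of x y drops by
    exactly 1/4 in each step ([mean_step_gap_product]). Summing up to time n,
      i j = E[x_n y_n; tau > n] + (1/4) sum_(k < n) P(tau > k)
    ([killed_gap_product]), and E[tau] = sum_k P(tau > k). So the claim
    E[tau] = 4 i j amounts to E[x_n y_n; tau > n] --> 0, a uniform
    integrability statement.

    It is supplied by a second function that grows faster than x y: the
    Vandermonde product x y (x + y) of the three positions is harmonic for the
    three walks and vanishes at collisions, hence
      E[x_n y_n (x_n + y_n); tau > n] = i j (i + j)
    for all n ([killed_gap_vandermonde]). Cutting at x + y = K gives
      E[x_n y_n; tau > n] <= K^2 P(tau > n) + i j (i + j) / K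
    ([killed_gap_product_le]). The identity above bounds the series of the
    P(tau > k) by 4 i j, so P(tau > n) --> 0, and K is arbitrary
    ([survival_series]).

    All of this concerns one explicit recursion on pairs of naturals. The
    measure-theoretic part identifies P(tau > n) with that recursion
    ([probability_survival]): the increments up to a given time form a
    uniformly distributed word in {+1, -1}^3, because the three cylinder events
    are independent ([probability_cylinder3]), and one conditions on the next
    letter ([probability_history_survival]). *)

Set Implicit Arguments.
Unset Strict Implicit.
Unset Printing Implicit Defensive.

Local Open Scope classical_set_scope.
Local Open Scope ring_scope.

Import Order.TTheory GRing.Theory Num.Theory.
Import numFieldNormedType.Exports.

(** * The pair of half-gaps killed at the boundary of the quadrant *)

Definition apart (x y : nat) : bool := (0 < x)%N && (0 < y)%N.

(** The bits are the signs of the two increments ([true] is +1), so that half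
    the difference of the increments is the difference of the bits. The
    subtraction does not truncate when x is positive. *)
Definition gap_step (x : nat) (l m : bool) : nat := (x + m - l)%N.

Lemma natr_gap_step (R : realType) x l m : (0 < x)%N ->
  (gap_step x l m)%:R = x%:R + m%:R - l%:R :> R.
Proof.
move=> x0; rewrite natrB ?natrD//; apply: leq_trans (leq_b1 l) _.
by rewrite ltn_addr.
Qed.

Section KilledExpectation.
Variable R : realType.
Implicit Types (f g : nat -> nat -> R) (x y n : nat).

(** The three bits are the steps of L, M and R; the step of M is shared by the
    two gaps. *)
Definition mean_step f x y : R :=
  8^-1 * \sum_(l : bool) \sum_(m : bool) \sum_(r : bool)
    f (gap_step x l m) (gap_step y m r).

(** This is E[f (x_n, y_n); tau > n] for the half-gaps started at (x, y). *)
Fixpoint killed f n x y : R :=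
  if apart x y then
    if n is n'.+1 then mean_step (killed f n') x y else f x y
  else 0.

(** P(tau > n) for the half-gaps started at (x, y). *)
Definition survival := killed (fun _ _ => 1).

Lemma eq_mean_step f g x y :
  (forall a b, f a b = g a b) -> mean_step f x y = mean_step g x y.
Proof.
by move=> fg; congr (_ * _); do 3!apply: eq_bigr => ? _; rewrite fg.
Qed.

Lemma le_mean_step f g x y :
  (forall a b, f a b <= g a b) -> mean_step f x y <= mean_step g x y.
Proof.
by move=> fg; rewrite ler_pM2l ?invr_gt0//; do 3!apply: ler_sum => ? _.
Qed.

Lemma mean_stepD f g x y :
  mean_step (fun a b => f a b + g a b) x y = mean_step f x y + mean_step g x y.
Proof.
rewrite -mulrDr -big_split; congr (_ * _); apply: eq_bigr => l _.
by rewrite -big_split; apply: eq_bigr => m _; rewrite -big_split.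
Qed.

Lemma mean_stepZ c f x y :
  mean_step (fun a b => c * f a b) x y = c * mean_step f x y.
Proof.
rewrite mulrCA mulr_sumr; congr (_ * _); apply: eq_bigr => l _.
by rewrite mulr_sumr; apply: eq_bigr => m _; rewrite mulr_sumr.
Qed.

Lemma killed_le f g n x y :
  (forall a b, f a b <= g a b) -> killed f n x y <= killed g n x y.
Proof.
move=> fg; elim: n x y => [|n IH] x y /=; case: ifP => // _.
exact: le_mean_step.
Qed.

Lemma killed_lin c1 c2 f g n x y :
  killed (fun a b => c1 * f a b + c2 * g a b) n x y =
  c1 * killed f n x y + c2 * killed g n x y.
Proof.
elim: n x y => [|n IH] x y /=; case: ifP => // _; rewrite ?mulr0 ?addr0//.
by rewrite (eq_mean_step _ _ IH) mean_stepD !mean_stepZ.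
Qed.

Lemma killed_ge0 f n x y : (forall a b, 0 <= f a b) -> 0 <= killed f n x y.
Proof.
move=> f0; elim: n x y => [|n IH] x y /=; case: ifP => // _.
by rewrite mulr_ge0 ?invr_ge0//; do 3!apply: sumr_ge0 => ? _.
Qed.

Lemma survival_ge0 n x y : 0 <= survival n x y.
Proof. exact: killed_ge0. Qed.

Definition gap_product x y : R := x%:R * y%:R.

(** Up to a constant, (M - L) (R - M) (R - L). *)
Definition gap_vandermonde x y : R := x%:R * y%:R * (x%:R + y%:R).

(** The increments of the two half-gaps are centred with covariance
    - Var(M step) / 4 = - 1/4. *)
Lemma mean_step_gap_product x y : apart x y ->
  mean_step gap_product x y = gap_product x y - 4^-1.
Proof.
move=> /andP[x0 y0]; rewrite /mean_step !big_bool /gap_product.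
by rewrite !natr_gap_step//=; field.
Qed.

(** The Vandermonde determinant is harmonic for independent walks with the same
    step law; here the eight outcomes are averaged explicitly. *)
Lemma mean_step_gap_vandermonde x y : apart x y ->
  mean_step gap_vandermonde x y = gap_vandermonde x y.
Proof.
move=> /andP[x0 y0]; rewrite /mean_step !big_bool /gap_vandermonde.
by rewrite !natr_gap_step//=; field.
Qed.

Lemma gap_product_eq0 x y : ~~ apart x y -> gap_product x y = 0.
Proof.
rewrite /apart /gap_product.
by case: x y => [|x] [|y]// _; rewrite ?mul0r ?mulr0.
Qed.

(** A harmonic function that vanishes where the process is killed keeps its
    killed expectation. *)
Lemma killed_gap_vandermonde n x y :
  killed gap_vandermonde n x y = gap_vandermonde x y.
Proof.
have bd a b : ~~ apart a b -> gap_vandermonde a b = 0.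
  move=> /gap_product_eq0; rewrite /gap_vandermonde /gap_product => ->.
  by rewrite mul0r.
elim: n x y => [|n IH] x y /=; case: ifPn => [xy|/bd ->]//.
by rewrite (eq_mean_step _ _ IH) mean_step_gap_vandermonde.
Qed.

(** Dynkin's formula for the function x y, whose drift is the constant - 1/4
    inside the quadrant and which vanishes where the process is killed. *)
Lemma killed_gap_product n x y :
  killed gap_product n x y =
  gap_product x y - 4^-1 * \sum_(0 <= k < n) survival k x y.
Proof.
elim: n x y => [|n IH] x y.
  by rewrite big_nil mulr0 subr0 /=; case: ifPn => // /gap_product_eq0.
rewrite big_nat_recl//= /survival /=.
case: ifPn => xy; last first.
  rewrite gap_product_eq0// big1 ?addr0 ?mulr0 ?subr0// => k _.
transitivity (mean_step (fun a b => gap_product a b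
   + (- 4^-1) * \sum_(0 <= k < n) survival k a b) x y).
  by apply: eq_mean_step => a b; rewrite IH mulNr.
rewrite mean_stepD mean_stepZ mean_step_gap_product// mulrDr mulr1.
suff -> : mean_step (fun a b => \sum_(0 <= k < n) survival k a b) x y =
   \sum_(0 <= k < n) mean_step (survival k) x y by rewrite opprD mulNr addrA.
elim: n {IH} => [|n IH].
  by rewrite big_nil /mean_step !big_bool/= !big_geq//; lra.
rewrite big_nat_recr//= -IH -mean_stepD; apply: eq_mean_step => a b.
by rewrite big_nat_recr.
Qed.

(** Pointwise x y <= K^2 when x + y <= K, and x y <= x y (x + y) / K otherwise;
    both bounds are nonnegative, so their sum dominates x y everywhere. *)
Lemma killed_gap_product_le K n x y : (0 < K)%N ->
  killed gap_product n x y <=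
  (K ^ 2)%:R * survival n x y + K%:R^-1 * gap_vandermonde x y.
Proof.
move=> K0; rewrite -(killed_gap_vandermonde n) -killed_lin.
apply: killed_le => a b; rewrite mulr1 /gap_product /gap_vandermonde.
have KR : 0 < K%:R :> R by rewrite ltr0n.
have [abK|abK] := leqP (a + b) K.
  apply: (@le_trans _ _ (K ^ 2)%:R).
    rewrite -natrM ler_nat expnS expn1 leq_mul// (leq_trans _ abK)//.
      exact: leq_addr.
    exact: leq_addl.
  by rewrite lerDl !mulr_ge0 ?invr_ge0 ?addr_ge0 ?ler0n.
apply: ler_wpDl; first by rewrite ler0n.
rewrite mulrCA ler_peMr ?mulr_ge0 ?ler0n// mulrC ler_pdivlMr// mul1r.
by rewrite -natrD ler_nat ltnW.
Qed.

(** By [killed_gap_product] the partial sums are 4 (x y - E[x_n y_n; tau > n]).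
    They are bounded, so the general term tends to 0, which through
    [killed_gap_product_le] makes the remaining expectation tend to 0. *)
Lemma survival_series x y :
  (\sum_(0 <= n <oo) (survival n x y)%:E)%E = (4 * gap_product x y)%:E.
Proof.
have kge0 n : 0 <= killed gap_product n x y.
  by apply: killed_ge0 => a b; rewrite mulr_ge0 ?ler0n.
have cS : cvgn (series (fun n => survival n x y)).
  apply: nondecreasing_is_cvgn.
    apply/nondecreasing_seqP => n.
    by rewrite /series/= big_nat_recr//= lerDl survival_ge0.
  exists (4 * gap_product x y) => _ [n _ <-].
  by have := kge0 n; rewrite killed_gap_product /series/=; lra.
have s0 := cvg_series_cvg_0 cS.
have k0 : killed gap_product n x y @[n --> \oo] --> (0 : R).
  apply/cvgrPdist_le => /= e e0.
  have V0 : 0 <= gap_vandermonde x y by rewrite !mulr_ge0 ?addr_ge0 ?ler0n.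
  (* K makes the Vandermonde term at most e / 2; then n makes the survival
     term at most e / 2. *)
  pose K := (Num.truncn (2 * gap_vandermonde x y / e)).+1.
  have K0 : 0 < K%:R :> R by rewrite ltr0n.
  have VK : K%:R^-1 * gap_vandermonde x y <= e / 2.
    rewrite mulrC ler_pdivrMr//.
    have := truncnS_gt (2 * gap_vandermonde x y / e); rewrite -/K ltr_pdivrMr//.
    by nra.
  have K20 : 0 < (K ^ 2)%:R :> R by rewrite ltr0n expn_gt0.
  have /cvgrPdist_le/(_ (e / 2 / (K ^ 2)%:R)) := s0.
  have e' : 0 < e / 2 / (K ^ 2)%:R by rewrite !divr_gt0.
  move=> /(_ e'); apply: filterS => n; rewrite !sub0r !normrN.
  rewrite (ger0_norm (survival_ge0 _ _ _)) (ger0_norm (kge0 _)).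
  rewrite ler_pdivlMr// mulrC => sn.
  apply: le_trans (killed_gap_product_le _ _ _ (isT : 0 < K)%N) _.
  by move: sn VK; lra.
apply/cvg_lim => //.
have -> : (fun n => \sum_(0 <= k < n) (survival k x y)%:E)%E =
  EFin \o (fun n => 4 * (gap_product x y - killed gap_product n x y)).
  apply/funext => n /=; rewrite sumEFin killed_gap_product; congr (_%:E); lra.
apply: cvg_EFin; first exact: nearW.
rewrite -[X in _ --> X]/(4 * gap_product x y) -{2}[gap_product x y]subr0.
by apply: cvgM; [exact: cvg_cst|apply: cvgB => //; exact: cvg_cst].
Qed.

End KilledExpectation.

(** * The collision time as a series of indicators *)

Section CollisionTime.
Context (T : Type) (R : realType).
Variables SL SM SR : nat -> T -> int.

(** The event tau > n. *)
Definition no_collision (n : nat) : set T :=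
  \bigcap_(k in [set k | (1 <= k <= n)%N])
    [set w | SL k w <> SM k w /\ SM k w <> SR k w].

(** If N is the first collision time, exactly the terms n < N are 1; without a
    collision all terms are 1 and both sides are infinite. *)
Lemma collision_time_series (w : T) :
  collision_time R SL SM SR w =
  (\sum_(0 <= n <oo) (\1_(no_collision n) w)%:E)%E.
Proof.
pose coll n := (0 < n)%N && ((SL n w == SM n w) || (SM n w == SR n w)).
have -> : collision_time R SL SM SR w =
    ereal_inf [set n%:R%:E | n in [set n | coll n]].
  apply/eqP; rewrite eq_le /collision_time; apply/andP; split.
    apply/ereal_infP => _ [n /andP[n0 /orP[]/eqP e] <-]; rewrite ge_min.
      by apply/orP; left; apply: ereal_inf_lbound; exists n.
    by apply/orP; right; apply: ereal_inf_lbound; exists n.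
  rewrite le_min; apply/andP; split; apply: ereal_inf_le_tmp => _ [n [n0 e] <-];
    by exists n => //=; rewrite /coll n0 e eqxx ?orbT.
have no n : no_collision n w <-> forall k, (k <= n)%N -> ~~ coll k.
  split=> [h k kn|h k /andP[k0 kn]].
    apply/negP => /andP[k0 /orP[]/eqP e].
      by have [] := h k; rewrite /= ?k0.
    by have [] := h k; rewrite /= ?k0.
  have := h _ kn; rewrite /coll k0/= negb_or => /andP[/eqP ? /eqP ?]; by split.
have [[n0 cn0]|nc] := pselect (exists n, coll n); last first.
  have -> : [set n%:R%:E | n in [set n | coll n]] = set0 :> set (\bar R).
    by rewrite -subset0 => _ [n /= cn _]; apply: nc; exists n.
  rewrite ereal_inf0; apply/esym.
  transitivity (\sum_(0 <= n <oo) (1%:E : \bar R))%E; last first.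
    apply/cvg_lim => //.
    rewrite (_ : (fun n => _) = fun n => (n%:R : R)%:E); last first.
      by apply/funext => n; rewrite sumEFin sumr_const_nat subn0.
    by apply/cvgenyP.
  apply: eq_eseriesr => n _; rewrite indicE mem_set//.
  by apply/no => k _; apply/negP => ck; apply: nc; exists k.
have exc : exists n, coll n by exists n0.
have cN := ex_minnP exc; case: cN => N cN Nmin.
transitivity (N%:R%:E : \bar R).
  apply/eqP; rewrite eq_le; apply/andP; split.
    by apply: ereal_inf_lbound; exists N.
  by apply/ereal_infP => _ [n /Nmin Nn <-]; rewrite lee_fin ler_nat.
rewrite (nneseries_split 0 N)//.
rewrite add0n eseries0 ?adde0; last first.
  move=> n Nn _; rewrite indicE memNset// => /no /(_ _ Nn); by rewrite cN.
rewrite big_mkord (eq_bigr (fun=> 1%:E)); last first.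
  move=> n _; rewrite indicE mem_set//; apply/no => k kn.
  by apply/negP => /Nmin; rewrite leqNgt (leq_ltn_trans kn).
by rewrite sumEFin sumr_const card_ord.
Qed.

End CollisionTime.

(** * Measurability of events on integer-valued functions *)

Section DiscreteMeasurability.
Context (d : measure_display) (T : measurableType d).

Definition point_measurable (f : T -> int) : Prop :=
  forall c, measurable (f @^-1` [set c]).

(** The event is the union of the countably many events f = a, g = b with
    F a b. *)
Lemma measurable_int_rel (F : int -> int -> Prop) (f g : T -> int) :
  point_measurable f -> point_measurable g ->
  measurable [set w | F (f w) (g w)].
Proof.
move=> mf mg.
have -> : [set w | F (f w) (g w)] =
  \bigcup_(p : int * int) (if pselect (F p.1 p.2) then
     f @^-1` [set p.1] `&` g @^-1` [set p.2] else set0).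
  apply/seteqP; split=> [w /= Fw|w [p _ /=]].
    by exists (f w, g w) => //=; case: pselect.
  by case: pselect => //= Fp [-> ->].
apply: countable_bigcupT_measurable; first exact: countableP.
move=> p; case: pselect => Fp; [exact: measurableI|exact: measurable0].
Qed.

Lemma walk_point_measurable (x : int) (X : nat -> T -> int) n :
  (forall k, point_measurable (X k)) -> point_measurable (walk x X n).
Proof.
move=> mX; elim: n => [|n IH] c.
  have -> : walk x X 0 @^-1` [set c] =
      [set w | (fun _ _ => x = c) (X 0%N w) (X 0%N w)].
    by apply/seteqP; split=> w; rewrite /walk /preimage/= big_ord0 addr0.
  exact: (measurable_int_rel (fun _ _ => x = c) (mX 0%N) (mX 0%N)).
have -> : walk x X n.+1 @^-1` [set c] =
    [set w | (fun a b => a + b = c) (walk x X n w) (X n w)].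
  by apply/seteqP; split=> w; rewrite /walk /preimage/= big_ord_recr/= addrA.
exact: (measurable_int_rel (fun a b => a + b = c) IH (mX n)).
Qed.

Lemma measurable_no_collision (SL SM SR : nat -> T -> int) n :
  (forall k, point_measurable (SL k)) -> (forall k, point_measurable (SM k)) ->
  (forall k, point_measurable (SR k)) -> measurable (no_collision SL SM SR n).
Proof.
move=> mL mM mR; apply: bigcap_measurableType => k _.
apply: measurableI (_ : measurable [set w | SL k w <> SM k w])
   (_ : measurable [set w | SM k w <> SR k w]).
  exact: (measurable_int_rel (fun a b => a <> b)).
exact: (measurable_int_rel (fun a b => a <> b)).
Qed.

End DiscreteMeasurability.

(** * Independent fair signs *)

Definition sign (b : bool) : int := if b then 1 else -1.

Definition cylinder (T : Type) (X : nat -> T -> int) (b : nat -> bool) n :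
  set T :=
  \bigcap_(k in `I_n) X k @^-1` [set sign (b k)].

Section FairSigns.
Context (d : measure_display) (T : measurableType d) (R : realType).
Variable P : probability T R.

Lemma rv_point_measurable (X : {RV P >-> int}) : point_measurable X.
Proof.
by move=> c; rewrite -[X in measurable X]setTI; apply: measurable_funPT.
Qed.

(** A fair sign may take values other than 1 and -1, but only on a null set. *)
Lemma fair_sign_split (X : {RV P >-> int}) (A : set T) :
  P (X @^-1` [set 1]) = (2^-1)%:E -> P (X @^-1` [set -1]) = (2^-1)%:E ->
  measurable A -> P A = (\sum_(b : bool) P (A `&` X @^-1` [set sign b]))%E.
Proof.
move=> p1 p2 mA; rewrite big_bool/=.
have m1 := rv_point_measurable X 1; have m2 := rv_point_measurable X (-1).
have dis : X @^-1` [set 1] `&` X @^-1` [set -1] = set0.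
  by rewrite -subset0 => w [/= -> ].
rewrite -measureU//; try exact: measurableI; last first.
  by rewrite setIACA dis setI0.
rewrite -setIUr; set B := _ `|` _.
have mB : measurable B by apply: measurableU.
have PB : P B = 1%E.
  by rewrite measureU//= p1 p2 -EFinD; congr (_%:E); lra.
have PC : P (~` B) = 0%E by rewrite probability_setC// PB subee.
rewrite (measureDI P mA mB) [X in (X + _)%E](_ : _ = 0%E) ?add0e//.
apply/eqP; rewrite -measure_le0 -PC; apply: le_measure; rewrite ?inE//.
exact: measurableD.
exact: measurableC.
Qed.

(** A cylinder lies in the sigma-algebra of its own sequence, so independence
    of the three sequences applies to triples of cylinders. *)
Lemma sigma_seq_cylinder (X : nat -> {RV P >-> int}) b n :
  sigma_seq X (cylinder X b n).
Proof.
apply: (@fin_bigcap_measurable _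
  (g_sigma_algebraType (\bigcup_k g_sigma_algebra_preimage (X k)))) => //.
move=> k _; apply: sub_sigma_algebra; exists k => //.
by exists [set sign (b k)] => //; rewrite setTI.
Qed.

Lemma probability_cylinder (X : nat -> {RV P >-> int}) b n :
  iid_fair_signs X -> P (cylinder X b n) = (2^-1 ^+ n)%:E.
Proof.
move=> [fair ind].
have := ind [fset k in iota 0 n]%fset (fun k => X k @^-1` [set sign (b k)]).
rewrite (_ : [set` [fset k in iota 0 n]%fset] = `I_n); last first.
  by apply/seteqP; split=> k /=; rewrite !inE/= mem_iota.
move=> ->; last first.
  by move=> k _; exists [set sign (b k)] => //; rewrite setTI.
rewrite (eq_bigr (fun=> (2^-1)%:E)); last first.
  by move=> k _; have [? ?] := fair k; case: (b k).
rewrite prodEFin; congr (_%:E).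
rewrite big_const_seq iter_mulr_1 count_predT; congr (_ ^+ _).
by rewrite -[size _]/(#|` _|)%fset card_fseq undup_id ?iota_uniq ?size_iota.
Qed.

Lemma probability_cylinder3 (X Y Z : nat -> {RV P >-> int}) a b c n :
  iid_fair_signs X -> iid_fair_signs Y -> iid_fair_signs Z ->
  independent_sequences3 X Y Z ->
  P (cylinder X a n `&` cylinder Y b n `&` cylinder Z c n) = (8^-1 ^+ n)%:E.
Proof.
move=> hX hY hZ ind.
pose E : 'I_3 -> set T :=
  tnth [tuple cylinder X a n; cylinder Y b n; cylinder Z c n].
have := ind [fset i | i in enum 'I_3]%fset E.
have JE : [set` [fset i | i in enum 'I_3]%fset] = [set: 'I_3].
  by apply/seteqP; split=> i //= _; rewrite !inE/= mem_enum.
rewrite JE (_ : \bigcap_(i in _) E i =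
  cylinder X a n `&` cylinder Y b n `&` cylinder Z c n).
  move=> ->; last first.
    move=> i _; case: i => -[|[|[|//]]] i3; exact: sigma_seq_cylinder.
  rewrite (perm_big (enum 'I_3)); last first.
    apply: uniq_perm; rewrite ?fset_uniq ?enum_uniq// => i.
    by rewrite !inE/=.
  rewrite big_enum/= !big_ord_recl big_ord0 /E !(tnth_nth set0)/=.
  rewrite !probability_cylinder// mule1 -!EFinM; congr (_%:E).
  by rewrite -!exprMn; congr (_ ^+ _); field.
apply/seteqP; split=> [w h|w [[h0 h1] h2] i _].
  by split; [split|]; [have := h ord0 I|have := h 1%R I|have := h 2%R I].
by case: i => -[|[|[|//]]] i3.
Qed.

End FairSigns.

(** * The survival probability *)

Lemma double_gap_step x l m : (0 < x)%N ->
  (2 * gap_step x l m)%:Z = (2 * x)%:Z + sign m - sign l.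
Proof. by rewrite /gap_step /sign; case: l m => [] []; lia. Qed.

Section Histories.
Variables i j : nat.
Implicit Type s : seq (bool * bool * bool).

(** A word [s] lists the signs of the steps of (L, M, R) with the latest step
    first, so that consing a letter extends the past by one step. *)
Fixpoint gaps s : nat * nat :=
  if s is (l, m, r) :: s' then
    (gap_step (gaps s').1 l m, gap_step (gaps s').2 m r)
  else (i, j).

(** Positivity is required at every time of the past, the present included. *)
Fixpoint alive s : bool :=
  apart (gaps s).1 (gaps s).2 && (if s is _ :: s' then alive s' else true).

Lemma alive_apart s : alive s -> apart (gaps s).1 (gaps s).2.
Proof. by case: s => [|v s] /andP[]. Qed.

Context (T : Type) (IL IM IR : nat -> T -> int).

Let SL := walk (- (2 * i)%:Z) IL.
Let SM := walk 0 IM.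
Let SR := walk (2 * j)%:Z IR.

Fixpoint history s : set T :=
  if s is (l, m, r) :: s' then
    history s' `&` IL (size s') @^-1` [set sign l]
               `&` IM (size s') @^-1` [set sign m]
               `&` IR (size s') @^-1` [set sign r]
  else setT.

(** The increments are indexed forwards in time, hence the reversal. *)
Lemma history_cylinder s : history s =
  cylinder IL (fun k => (nth (true, true, true) (rev s) k).1.1) (size s) `&`
  cylinder IM (fun k => (nth (true, true, true) (rev s) k).1.2) (size s) `&`
  cylinder IR (fun k => (nth (true, true, true) (rev s) k).2) (size s).
Proof.
elim: s => [|[[l m] r] s IH]; apply/seteqP; split.
- by move=> w _; split; [split|].
- by [].
- move=> w /= [[[]]]; rewrite IH => -[[hL hM] hR] eL eM eR.
  split; [split|] => k /=; rewrite ltnS leq_eqVlt => /orP[/eqP ->|ks];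
    rewrite rev_cons nth_rcons size_rev ?ltnn ?eqxx ?ks//;
    [exact: hL|exact: hM|exact: hR].
- move=> w [[hL hM] hR] /=; split; [split; [split|]|].
  + rewrite IH; split; [split|] => k /= ks;
      [have := hL k|have := hM k|have := hR k];
      by rewrite /= rev_cons nth_rcons size_rev ks; apply; exact: ltnW.
  + have := hL (size s); rewrite /= rev_cons nth_rcons size_rev ltnn eqxx.
    exact.
  + have := hM (size s); rewrite /= rev_cons nth_rcons size_rev ltnn eqxx.
    exact.
  + have := hR (size s); rewrite /= rev_cons nth_rcons size_rev ltnn eqxx.
    exact.
Qed.

(** The current gaps may be 0; only the earlier ones are positive, which keeps
    [gap_step] from truncating. *)
Lemma history_gaps s w : alive (behead s) -> history s w ->
  SM (size s) w - SL (size s) w = (2 * (gaps s).1)%:Z /\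
  SR (size s) w - SM (size s) w = (2 * (gaps s).2)%:Z.
Proof.
elim: s => [|[[l m] r] s IH] /=.
  by rewrite /SL /SM /SR /walk !big_ord0; split; lia.
move=> als [[[hs eL] eM] eR]; move: eL eM eR; rewrite /preimage/= => eL eM eR.
have als' : alive (behead s) by case: s als {IH hs eL eM eR} => //= v s /andP[].
have [e1 e2] := IH als' hs.
have /andP[g1 g2] := alive_apart als.
move: e1 e2; rewrite /SL /SM /SR /walk !big_ord_recr/= eL eM eR.
by rewrite !double_gap_step// => <- <-; split; ring.
Qed.

Lemma alive_history s :
  alive s -> history s `<=` no_collision SL SM SR (size s).
Proof.
elim: s => [|[[l m] r] s IH] als w hs k /=; first by case: k.
move=> /andP[k0]; rewrite leq_eqVlt => /orP[/eqP ->|ks]; last first.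
  move: als hs => /= /andP[_ als] [[[hs _] _] _].
  by apply: (IH als w hs k); rewrite /= k0.
have [||e1 e2] := @history_gaps ((l, m, r) :: s) w.
- by move: als => /= /andP[].
- exact: hs.
have /andP[] := alive_apart als; move: e1 e2 => /=; lia.
Qed.

End Histories.

Section Survival.
Context (d : measure_display) (T : measurableType d) (R : realType).
Variables (P : probability T R) (i j : nat) (IL IM IR : nat -> {RV P >-> int}).
Hypotheses (hL : iid_fair_signs IL) (hM : iid_fair_signs IM).
Hypotheses (hR : iid_fair_signs IR) (hind : independent_sequences3 IL IM IR).

Let B := no_collision (walk (- (2 * i)%:Z) IL) (walk 0 IM) (walk (2 * j)%:Z IR).

Lemma measurable_survival n : measurable (B n).
Proof.
by apply: measurable_no_collision => k; apply: walk_point_measurable => m;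
  exact: rv_point_measurable.
Qed.

Lemma measurable_history s : measurable (history IL IM IR s).
Proof.
elim: s => [|[[l m] r] s IH] //=.
by do 3![apply: measurableI; last exact: rv_point_measurable].
Qed.

(** Markov property of the half-gaps, by induction on the number [n] of
    remaining steps: splitting according to the next signs of L, M and R gives
    eight words [s']. If the gaps of [s'] are positive, the induction hypothesis
    applies; otherwise a collision occurs at time [size s'] and both sides
    are 0. *)
Lemma probability_history_survival s n : alive i j s ->
  P (history IL IM IR s `&` B (size s + n)) =
  (8^-1 ^+ size s * survival R n (gaps i j s).1 (gaps i j s).2)%:E.
Proof.
elim: n s => [|n IH] s als; have aps := alive_apart als.
  rewrite addn0 setIidl; last exact: alive_history.
  by rewrite history_cylinder probability_cylinder3// /survival/= aps mulr1.
have mh := measurable_history s; have mB := measurable_survival.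
have [pL1 pL2] := hL.1 (size s); have [pM1 pM2] := hM.1 (size s).
have [pR1 pR2] := hR.1 (size s).
rewrite (fair_sign_split pL1 pL2); last exact: measurableI.
rewrite /survival/= aps /mean_step mulrA -exprSr mulr_sumr -sumEFin.
apply: eq_bigr => l _; rewrite (fair_sign_split pM1 pM2); last first.
  by do !apply: measurableI => //; exact: rv_point_measurable.
rewrite mulr_sumr -sumEFin; apply: eq_bigr => m _.
rewrite (fair_sign_split pR1 pR2); last first.
  by do !apply: measurableI => //; exact: rv_point_measurable.
rewrite mulr_sumr -sumEFin; apply: eq_bigr => r _.
pose s' := (l, m, r) :: s.
transitivity (P (history IL IM IR s' `&` B (size s' + n))).
  congr (P _); rewrite /= addSnnS; apply/seteqP; split=> w /=; tauto.
case aps' : (apart (gaps i j s').1 (gaps i j s').2).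
  by rewrite IH//= -/s' aps' als.
rewrite (_ : _ `&` _ = set0); last first.
  rewrite -subset0 => w [hs' Bw].
  have [||e1 e2] := @history_gaps i j _ IL IM IR s' w => //.
  have [|c1 c2] := Bw (size s'); first by rewrite /= leq_addr.
  move: aps' e1 e2; rewrite /apart => /negbT; rewrite negb_and -!eqn0Ngt.
  move=> /orP[]/eqP->; rewrite muln0; first by move=> /subr0_eq /esym.
  by move=> _ /subr0_eq /esym.
rewrite measure0 /survival.
by move: aps'; case: (n) => /= [|n'] ->; rewrite mulr0.
Qed.

Lemma probability_survival n : (0 < i)%N -> (0 < j)%N ->
  P (B n) = (survival R n i j)%:E.
Proof.
move=> i0 j0; have := @probability_history_survival [::] n.
by rewrite /= /apart i0 j0 setTI add0n mul1r; apply.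
Qed.

End Survival.

(* The expectation is written as an integral because the collision time takes
   values in \bar R, whereas the library's 'E_P[X] is for real-valued X. *)
Theorem theorem3p3 (R : realType) (d : measure_display) (T : measurableType d)
    (P : probability T R) (i j : nat) (hi : (1 <= i)%N) (hj : (1 <= j)%N)
    (IL IM IR : nat -> {RV P >-> int})
    (hL : iid_fair_signs IL) (hM : iid_fair_signs IM) (hR : iid_fair_signs IR)
    (hind : independent_sequences3 IL IM IR) :
  (\int[P]_w collision_time R (walk (- (2 * i)%:Z) IL) (walk 0 IM)
                              (walk (2 * j)%:Z IR) w)%E
  = (4 * i * j)%:R%:E.
Proof.
have mB := measurable_survival i j IL IM IR.
under eq_integral do rewrite collision_time_series.
rewrite integral_nneseries//; last first.
  by move=> n; apply/measurable_EFinP; exact: measurable_indic.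
rewrite (_ : (4 * i * j)%:R = 4 * gap_product R i j); last first.
  by rewrite !natrM mulrA.
rewrite -survival_series; apply: eq_eseriesr => n _.
rewrite integral_indic// setIT.
exact: (probability_survival hL hM hR hind).
Qed.
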